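(* For every list $Q$ of sequences (as in the context), the optimal objective value of the following integer linear program equals the minimum number $p$ such that there is a processing of $Q$ in which in each configuration at most $p$ pallets are open. Variables: binary $x_i^j$ for $i,j\in[n]$; an integer variable $p$; binary $g(t,c),h(t,c),f(t,c)$ for $t\in[m]$, $c\in[n-1]$. Minimize $p$ subject to: (1) $\sum_{j=1}^n x_i^j=1$ for every $i\in[n]$, and $\sum_{i=1}^n x_i^j=1$ for every $j\in[n]$; (2) for every $\ell\in[k]$, all $i,i'$ with $n_{\ell-1}+1\le i<i'\le n_\ell$ and all $j,j'\in[n]$ with $j'<j$: $x_{i'}^{j'}\le 1-x_i^j$; and for every $\ell\in[k]$, all $i,i'$ with $n_{\ell-1}+1\le i'<i\le n_\ell$ and all $j,j'\in[n]$ with $j'>j$: $x_{i'}^{j'}\le 1-x_i^j$; (3) $\sum_{t=1}^m f(t,c)\le p$ for every $c\in[n-1]$; (4) $x_i^j-g(t,c)\le 0$ for all $t\in[m]$, $c\in[n-1]$, $i\in[n]$ with ${\it plt}(b_i)=t$, $j\le c$; and $\sum_{i\in[n],\,j\le c,\,{\it plt}(b_i)=t} x_i^j - g(t,c)\ge 0$ for all $t\in[m]$, $c\in[n-1]$; (5) $x_i^j-h(t,c)\le 0$ for all $t\in[m]$, $c\in[n-1]$, $i\in[n]$ with ${\it plt}(b_i)=t$, $j> c$; and $\sum_{i\in[n],\,j> c,\,{\it plt}(b_i)=t} x_i^j - h(t,c)\ge 0$ for all $t\in[m]$, $c\in[n-1]$; (6) $f(t,c)-g(t,c)\le 0$, $f(t,c)-h(t,c)\le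 0$, and $g(t,c)+h(t,c)-f(t,c)\le 1$ for all $t\in[m]$, $c\in[n-1]$.
   Context: FIFO Stack-Up problem. An instance consists of a list $Q=(q_1,\ldots,q_k)$ of sequences of pairwise distinct bins, where the bins are numbered $b_1,\ldots,b_n$ so that $q_\ell=(b_{n_{\ell-1}+1},\ldots,b_{n_\ell})$ with $0=n_0<n_1<\cdots<n_k=n$; each bin $b$ has a pallet symbol ${\it plt}(b)$, and the distinct pallet symbols (pallets) are $1,\ldots,m$. Standing assumption: every pallet is carried by at least two bins. A configuration is a tuple $(i_1,\ldots,i_k)$ with $0\le i_j\le |q_j|$, meaning that the first $i_j$ bins of $q_j$ have been removed. A pallet $t$ is open in configuration $(i_1,\ldots,i_k)$ if there are indices $j,\ell$ such that some bin for $t$ is at a position $\le i_j$ in $q_j$ and some bin for $t$ is at a position $> i_\ell$ in $q_\ell$. A transformation step removes the bin at position $i_j+1$ of some sequence $q_j$ (with $i_j<|q_j|$). A processing of $Q$ is a sequence of transformation steps from $(0,\ldots,0)$ to $(|q_1|,\ldots,|q_k|)$. $[n]=\{1,\ldots,n\}$. *)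

(* Defs.v *)
From HB Require Import structures.
From mathcomp Require Import all_boot all_order all_algebra.

Set Implicit Arguments.
Unset Strict Implicit.
Unset Printing Implicit Defensive.

Import Order.TTheory GRing.Theory Num.Theory.

(* All indices are shifted to start at 0: the bins b_1, ..., b_n are the
   elements of 'I_n, the pallets 1, ..., m those of 'I_m, and the sequences
   q_1, ..., q_k are tnth Q l for l : 'I_k. *)

(* flatten Q = enum 'I_n says that the bins are numbered consecutively along
   q_1, ..., q_k; in particular they are pairwise distinct. Nonempty sequences
   and 0 < k express n_0 < n_1 < ... < n_k. *)
Definition fifo_instance (k n m : nat) (Q : k.-tuple (seq 'I_n))
    (plt : 'I_n -> 'I_m) : Prop :=
  [/\ (0 < k)%N,
      forall l : 'I_k, tnth Q l <> [::],
      flatten Q = enum 'I_n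
    & forall t : 'I_m, (2 <= #|[set b | plt b == t]|)%N].

(* The sum of the lengths of the first l sequences, i.e. n_l. Hence, with
   0-based indices, q_(l+1) consists of the bins i with
   n_l <= i < n_(l+1). *)
Definition bound (k n : nat) (Q : k.-tuple (seq 'I_n)) (l : nat) : nat :=
  sumn (take l (shape Q)).

(* The bounds c j <= size (tnth Q j) are not part of the type: they hold in the
   initial configuration and are preserved by transformation steps. *)
Definition config (k : nat) := {ffun 'I_k -> nat}.

Definition initial_config (k : nat) : config k := [ffun=> 0%N].

Definition final_config (k n : nat) (Q : k.-tuple (seq 'I_n)) : config k :=
  [ffun j => size (tnth Q j)].

Definition step (k n : nat) (Q : k.-tuple (seq 'I_n)) : rel (config k) :=
  fun c c' => [exists j : 'I_k, (c j < size (tnth Q j))%N &&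
                 (c' == [ffun l => if l == j then (c l).+1 else c l])].

Definition is_open (k n m : nat) (Q : k.-tuple (seq 'I_n))
    (plt : 'I_n -> 'I_m) (c : config k) (t : 'I_m) : bool :=
  [exists j : 'I_k, exists l : 'I_k,
     has (fun b => plt b == t) (take (c j) (tnth Q j)) &&
     has (fun b => plt b == t) (drop (c l) (tnth Q l))].

(* s lists the configurations reached after the initial one. *)
Definition processing (k n : nat) (Q : k.-tuple (seq 'I_n))
    (s : seq (config k)) : bool :=
  path (step Q) (initial_config k) s &&
  (last (initial_config k) s == final_config Q).

Definition processable_with (k n m : nat) (Q : k.-tuple (seq 'I_n))
    (plt : 'I_n -> 'I_m) (p : nat) : Prop :=
  exists2 s : seq (config k), processing Q s &
    forall c : config k, c \in initial_config k :: s ->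
      (#|[set t | is_open Q plt c t]| <= p)%N.

(* x i j stands for x_(i+1)^(j+1), and g t c, h t c, f t c for the variables of
   column c + 1; the shift preserves the comparisons j <= c and j > c. *)
Record ilp_point (n m : nat) := IlpPoint {
  x_ : 'I_n -> 'I_n -> int;
  p_ : int;
  g_ : 'I_m -> 'I_n.-1 -> int;
  h_ : 'I_m -> 'I_n.-1 -> int;
  f_ : 'I_m -> 'I_n.-1 -> int
}.

Local Open Scope ring_scope.

Definition binary (v : int) : Prop := v = 0 \/ v = 1.

Definition ilp_binary (n m : nat) (v : ilp_point n m) : Prop :=
  (forall i j, binary (x_ v i j)) /\
  (forall t c, [/\ binary (g_ v t c), binary (h_ v t c) & binary (f_ v t c)]).

Definition ilp_bijection (n m : nat) (v : ilp_point n m) : Prop :=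
  (forall i : 'I_n, \sum_(j < n) x_ v i j = 1) /\
  (forall j : 'I_n, \sum_(i < n) x_ v i j = 1).

Definition ilp_fifo (k n m : nat) (Q : k.-tuple (seq 'I_n))
    (v : ilp_point n m) : Prop :=
  (forall (l : 'I_k) (i i' j j' : 'I_n),
     (bound Q l <= i)%N -> (i < i')%N -> (i' < bound Q l.+1)%N ->
     (j' < j)%N -> x_ v i' j' <= 1 - x_ v i j) /\
  (forall (l : 'I_k) (i i' j j' : 'I_n),
     (bound Q l <= i')%N -> (i' < i)%N -> (i < bound Q l.+1)%N ->
     (j < j')%N -> x_ v i' j' <= 1 - x_ v i j).

Definition ilp_capacity (n m : nat) (v : ilp_point n m) : Prop :=
  forall c : 'I_n.-1, \sum_(t < m) f_ v t c <= p_ v.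

Definition ilp_removed (n m : nat) (plt : 'I_n -> 'I_m)
    (v : ilp_point n m) : Prop :=
  (forall (t : 'I_m) (c : 'I_n.-1) (i j : 'I_n),
     plt i = t -> (j <= c)%N -> x_ v i j - g_ v t c <= 0) /\
  (forall (t : 'I_m) (c : 'I_n.-1),
     0 <= (\sum_(i < n | plt i == t) \sum_(j < n | (j <= c)%N) x_ v i j)
          - g_ v t c).

Definition ilp_remaining (n m : nat) (plt : 'I_n -> 'I_m)
    (v : ilp_point n m) : Prop :=
  (forall (t : 'I_m) (c : 'I_n.-1) (i j : 'I_n),
     plt i = t -> (c < j)%N -> x_ v i j - h_ v t c <= 0) /\
  (forall (t : 'I_m) (c : 'I_n.-1),
     0 <= (\sum_(i < n | plt i == t) \sum_(j < n | (c < j)%N) x_ v i j)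
          - h_ v t c).

Definition ilp_open (n m : nat) (v : ilp_point n m) : Prop :=
  forall (t : 'I_m) (c : 'I_n.-1),
    [/\ f_ v t c - g_ v t c <= 0,
        f_ v t c - h_ v t c <= 0
      & g_ v t c + h_ v t c - f_ v t c <= 1].

Definition ilp_feasible (k n m : nat) (Q : k.-tuple (seq 'I_n))
    (plt : 'I_n -> 'I_m) (v : ilp_point n m) : Prop :=
  [/\ ilp_binary v, ilp_bijection v & ilp_fifo Q v] /\
  [/\ ilp_capacity v, ilp_removed plt v, ilp_remaining plt v & ilp_open v].

Definition ilp_optimal_value (k n m : nat) (Q : k.-tuple (seq 'I_n))
    (plt : 'I_n -> 'I_m) (z : int) : Prop :=
  (exists2 v : ilp_point n m, ilp_feasible Q plt v & p_ v = z) /\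
  (forall v : ilp_point n m, ilp_feasible Q plt v -> z <= p_ v).

Definition min_open_pallets (k n m : nat) (Q : k.-tuple (seq 'I_n))
    (plt : 'I_n -> 'I_m) (p : nat) : Prop :=
  processable_with Q plt p /\
  (forall p' : nat, processable_with Q plt p' -> (p <= p')%N).

(* Main.v *)
(* Both sides of the theorem range over removal orders, i.e. permutations s of
   the bins (s b is the time at which b is removed) that increase along every
   sequence. The configurations met by a processing are exactly the sets of bins
   removed before time d in such an order, and the permutation matrices
   satisfying (2) are those of such orders. A pallet is open at time d iff its
   bins are split by that set, and (4)-(6) force f to be the indicator of this. *)

Require Import Defs.
From HB Require Import structures.
From mathcomp Require Import all_boot all_order all_algebra.
From mathcomp Require Import fingroup perm zify.

Set Implicit Arguments.
Unset Strict Implicit.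
Unset Printing Implicit Defensive.

Import Order.TTheory GRing.Theory Num.Theory.

(** Once [a] fails along [r] it never holds again, so the elements satisfying it form a prefix. *)
Lemma filter_take_count (T : Type) (a : pred T) (r : seq T) :
  pairwise (fun x y => a y ==> a x) r -> filter a r = take (count a r) r.
Proof.
elim: r => //= x r IH /andP[xr /IH e]; case: ifP => ax /=; first by rewrite e.
have /eqP c0 : count a r == 0.
  rewrite eqn0Ngt -has_count -all_predC.
  by apply: sub_all xr => y /=; rewrite ax implybF.
by rewrite e c0 !take0.
Qed.

(** * Sequences as blocks of consecutive bins, and sets of removed bins *)

Section Blocks.
Variables (k n : nat) (Q : k.-tuple (seq 'I_n)).
Hypothesis flatQ : flatten Q = enum 'I_n.
Implicit Types (c : config k) (l : 'I_k) (b : 'I_n).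

Lemma boundS l : bound Q l.+1 = bound Q l + size (tnth Q l).
Proof.
rewrite /bound (take_nth 0) ?size_map ?size_tuple //.
by rewrite -cats1 sumn_cat /= addn0 (nth_map [::]) ?size_tuple // -tnth_nth.
Qed.

(** [flatten Q] reads off the numbers from 0 to [n - 1]; skipping the lengths of the earlier
    sequences leaves an interval. *)
Lemma map_val_block l :
  map val (tnth Q l) = iota (bound Q l) (size (tnth Q l)).
Proof.
have eQ : flatten Q = flatten (take l Q) ++ tnth Q l ++ flatten (drop l.+1 Q).
  rewrite -{1}(cat_take_drop l Q) flatten_cat (drop_nth [::]) ?size_tuple //=.
  by rewrite -tnth_nth.
have sz : size (flatten (take l Q)) = bound Q l.
  by rewrite size_flatten /bound /shape map_take.
have := val_enum_ord n; rewrite -flatQ eQ !map_cat => e.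
have sn := congr1 size e.
rewrite !size_cat !size_map sz size_iota in sn.
have -> : map val (tnth Q l) =
    take (size (tnth Q l)) (drop (bound Q l) (iota 0 n)).
  by rewrite -e drop_size_cat ?size_map // take_size_cat ?size_map.
rewrite drop_iota take_iota add0n; congr iota; apply/minn_idPl.
by rewrite leq_subRL -[X in _ <= X]sn ?leq_add2l leq_addr.
Qed.

Lemma mem_take_block b l d :
  (b \in take d (tnth Q l)) =
  (bound Q l <= b < bound Q l + minn d (size (tnth Q l))).
Proof.
rewrite -(mem_map val_inj) map_take map_val_block take_iota mem_iota.
by [].
Qed.

Lemma mem_block b l :
  (b \in tnth Q l) = (bound Q l <= b < bound Q l.+1).
Proof. by rewrite -[tnth Q l]take_size mem_take_block minnn boundS. Qed.

Lemma uniq_block l : uniq (tnth Q l).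
Proof. by rewrite -(map_inj_uniq val_inj) map_val_block iota_uniq. Qed.

Lemma bound_homo l l' : l < l' -> bound Q l.+1 <= bound Q l'.
Proof.
move=> lt; rewrite /bound -(cat_take_drop l.+1 (take l' (shape Q))).
by rewrite sumn_cat take_takel // leq_addr.
Qed.

Lemma block_inj b l l' : b \in tnth Q l -> b \in tnth Q l' -> l = l'.
Proof.
rewrite !mem_block => hl hl'; apply: val_inj => /=.
by case: (ltngtP l l') => // /bound_homo; lia.
Qed.

Lemma block_ex b : exists l, b \in tnth Q l.
Proof.
have : b \in flatten Q by rewrite flatQ mem_enum.
by case/flattenP=> q /tnthP[l ->] bq; exists l.
Qed.

Definition removed c : {set 'I_n} :=
  [set b | [exists l, b \in take (c l) (tnth Q l)]].

Lemma removedE c b l :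
  b \in tnth Q l -> (b \in removed c) = (b \in take (c l) (tnth Q l)).
Proof.
move=> bl; rewrite inE; apply/existsP/idP=> [[l' bl']|]; last by exists l.
by rewrite (block_inj bl (mem_take bl')).
Qed.

(** No bin repeats within a sequence, so its prefix and suffix are disjoint. *)
Lemma mem_drop_block c b l :
  b \in tnth Q l -> (b \in drop (c l) (tnth Q l)) = (b \notin removed c).
Proof.
move=> bl; rewrite (removedE c bl).
have := uniq_block l; move: bl; rewrite -{1 2}(cat_take_drop (c l) (tnth Q l)).
rewrite mem_cat cat_uniq => bl /and3P[_ /hasPn disj _].
apply/idP/idP=> [/disj //|nb]; by move: bl; rewrite (negbTE nb).
Qed.

Lemma removed_initial : removed (initial_config k) = set0.
Proof.
by apply/setP=> b; rewrite !inE; apply/existsP=> -[l]; rewrite ffunE take0.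
Qed.

Lemma removed_final : removed (final_config Q) = setT.
Proof.
apply/setP=> b; rewrite !inE; have [l bl] := block_ex b.
by apply/existsP; exists l; rewrite ffunE take_size.
Qed.

(** Removal takes a prefix of each sequence, and bin numbers increase along it. *)
Lemma removed_down c l b b' :
  b \in tnth Q l -> b' \in tnth Q l -> b < b' ->
  b' \in removed c -> b \in removed c.
Proof.
move=> bl b'l lt; rewrite (removedE _ bl) (removedE _ b'l) !mem_take_block.
by move: bl; rewrite mem_block; lia.
Qed.

Lemma removed_step c c' : step Q c c' ->
  exists2 b, b \notin removed c & removed c' = b |: removed c.
Proof.
case/existsP=> l /andP[lt /eqP ->].
(* [nth] needs a default bin; with [n = 0] there is no bin to remove. *)
case: (n =P 0) => [n0|/eqP n0].
  by have := map_val_block l; case: (tnth Q l) lt => // b; case: b; lia.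
have x0 : 'I_n by exists 0; lia.
set b := nth x0 (tnth Q l) (c l).
have bl : b \in tnth Q l by rewrite mem_nth.
exists b.
  by rewrite (removedE _ bl) in_take // index_uniq ?uniq_block // ltnn.
apply/setP=> b'; have [l' b'l] := block_ex b'.
rewrite in_setU1 !(removedE _ b'l) ffunE; case: eqP => [e|ne].
  by rewrite e (take_nth x0) // mem_rcons inE.
by case: eqP => // e; case: ne; apply: (block_inj b'l); rewrite e.
Qed.

(** [r] lists the bins in the order in which the steps remove them. The start [c] is arbitrary for
    the induction, whence the disjointness from [removed c]. *)
Lemma path_removal_order c s : path (step Q) c s ->
  exists2 r : seq 'I_n,
    [/\ size r = size s, uniq r & [disjoint r & removed c]] &
    forall i, i <= size s ->
      removed (nth c (c :: s) i) = [set b in take i r] :|: removed c.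
Proof.
elim: s c => [|c' s IH] c /=.
  move=> _; exists [::] => [|[|i]//= _]; first by split=> //; apply/pred0P=> b.
  by apply/setP=> b; rewrite !inE.
case/andP=> /removed_step[b nb eb] /IH[r [sr ur dr] hr].
have nbr : b \notin r.
  by apply/negP=> br; have := disjointFr dr br; rewrite eb !inE eqxx.
exists (b :: r).
  split=> /=; rewrite ?sr ?nbr //; apply/pred0P=> x /=; rewrite !inE.
  have := pred0P dr x; rewrite eb /= !inE.
  by case: eqP => [->|_] /=; [move: nb; rewrite inE => /negbTE-> | ].
case=> [_|i le] /=; first by apply/setP=> x; rewrite !inE.
rewrite (set_nth_default c') //= hr // eb; apply/setP=> x.
by rewrite !inE orbCA orbA.
Qed.

End Blocks.

(** * Open pallets as pallets split by a set of bins *)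

Section Openness.
Variables (n m : nat) (plt : 'I_n -> 'I_m).

Definition splits (A : {set 'I_n}) (t : 'I_m) : bool :=
  [exists b in A, plt b == t] && [exists b in ~: A, plt b == t].

Definition width (A : {set 'I_n}) : nat := #|[set t | splits A t]|.

Definition before (s : {perm 'I_n}) (d : nat) : {set 'I_n} :=
  [set b | s b < d].

(** The indices [j] and [l] in the definition of openness are chosen independently, so only the set
    of removed bins matters. *)
Lemma is_openE k (Q : k.-tuple (seq 'I_n)) c t :
  flatten Q = enum 'I_n -> is_open Q plt c t = splits (removed Q c) t.
Proof.
move=> flatQ; apply/existsP/andP=> [[j /existsP[l /andP[]]]|[]].
  case/hasP=> b bj bt /hasP[b' b'l b't].
  split; apply/existsP; [exists b | exists b']; apply/andP; split=> //.
    by rewrite (removedE flatQ _ (mem_take bj)).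
  by rewrite inE -(mem_drop_block flatQ _ (mem_drop b'l)).
case/existsP=> b /andP[bA bt] /existsP[b' /andP[b'A b't]].
have [[j bj] [l b'l]] := (block_ex flatQ b, block_ex flatQ b').
exists j; apply/existsP; exists l; apply/andP; split; apply/hasP.
  by exists b; rewrite // -(removedE flatQ _ bj).
by exists b'; rewrite // (mem_drop_block flatQ) // -in_setC.
Qed.

Lemma width0 : width set0 = 0.
Proof.
apply: eq_card0 => t; rewrite !inE; apply/andP=> -[/existsP[b]].
by rewrite inE.
Qed.

Lemma widthT : width setT = 0.
Proof.
apply: eq_card0 => t; rewrite !inE; apply/andP=> -[_ /existsP[b]].
by rewrite !inE.
Qed.

Lemma width_le A : width A <= m.
Proof. by rewrite -[X in _ <= X]card_ord max_card. Qed.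

End Openness.

(** * Removal orders and processings *)

Section Orders.
Variables (k n m : nat) (Q : k.-tuple (seq 'I_n)) (plt : 'I_n -> 'I_m).
Hypothesis flatQ : flatten Q = enum 'I_n.
Implicit Types (s : {perm 'I_n}) (p : nat).

Definition fifo_order s : bool :=
  [forall l, forall b in tnth Q l, forall b' in tnth Q l,
     (b < b') ==> (s b < s b')].

(** The times tested are 1 to [n - 1], one per column of the program. At any other time no bin or
    every bin is removed, and the width is 0. *)
Definition order_width_le s p : bool :=
  [forall d : 'I_n.-1, width plt (before s d.+1) <= p].

Lemma fifo_orderP s :
  reflect (forall l b b', b \in tnth Q l -> b' \in tnth Q l -> b < b' ->
             s b < s b') (fifo_order s).
Proof.
apply: (iffP forallP) => [h l b b' bl b'l lt|h l].
  by have /forall_inP/(_ b bl)/forall_inP/(_ b' b'l)/implyP := h l; apply.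
apply/forall_inP=> b bl; apply/forall_inP=> b' b'l; apply/implyP.
exact: h bl b'l.
Qed.

Lemma order_width_leP s p :
  reflect (forall d, width plt (before s d) <= p) (order_width_le s p).
Proof.
apply: (iffP forallP) => [h d|h d]; last exact: h.
case: d => [|d].
  suff -> : before s 0 = set0 by rewrite width0.
  by apply/setP=> b; rewrite !inE.
case: (ltnP d n.-1) => [lt|le]; first exact: (h (Ordinal lt)).
suff -> : before s d.+1 = setT by rewrite widthT.
by apply/setP=> b; rewrite !inE; have := ltn_ord (s b); lia.
Qed.

(** The final configuration has lost every bin, so the list of removals contains each bin once; its
    index there is its time. *)
Lemma processing_order p : processable_with Q plt p ->
  exists s, fifo_order s && order_width_le s p.
Proof.
case=> cs /andP[path_cs /eqP last_cs] open_le.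
have [r [size_r uniq_r _] hr] := path_removal_order flatQ path_cs.
have {}hr i : i <= size cs ->
    removed Q (nth (initial_config k) (initial_config k :: cs) i)
    = [set b in take i r].
  by move/hr->; rewrite removed_initial setU0.
have all_r b : b \in r.
  have := hr _ (leqnn _); rewrite -size_r take_size size_r.
  rewrite nth_last /= last_cs removed_final //.
  by move/setP/(_ b); rewrite !inE.
have size_rn : size r = n.
  rewrite -(card_uniqP uniq_r) -[RHS]card_ord.
  by apply: eq_card => b; rewrite all_r inE.
have index_lt b : index b r < n by rewrite -{2}size_rn index_mem.
pose f b := Ordinal (index_lt b).
have f_inj : injective f.
  move=> b b' /(congr1 val) /= e.
  by rewrite -(nth_index b (all_r b)) e nth_index.
exists (perm f_inj).
have removedE' i : i <= n ->
    removed Q (nth (initial_config k) (initial_config k :: cs) i)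
    = before (perm f_inj) i.
  move=> le; rewrite hr -?size_r ?size_rn //.
  by apply/setP=> b; rewrite !inE permE /= in_take.
apply/andP; split.
  apply/fifo_orderP=> l b b' bl b'l lt.
  (* Right after the removal of [b'] the bin [b] is gone too, so [b] is not later than [b'];
     injectivity excludes equal times. *)
  have := removed_down (c := nth (initial_config k) (initial_config k :: cs)
    (perm f_inj b').+1) flatQ bl b'l lt.
  rewrite removedE' // !inE ltnSn => /(_ isT); rewrite ltnS leq_eqVlt.
  case/orP=> // /eqP /val_inj /perm_inj e; by rewrite e ltnn in lt.
apply/forallP=> d; have dn : d.+1 <= n by have := ltn_ord d; lia.
rewrite -removedE' // /width.
rewrite (eq_card (B := [set t | is_open Q plt
    (nth (initial_config k) (initial_config k :: cs) d.+1) t])).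
  by apply: open_le; rewrite mem_nth //= -size_r size_rn ltnS.
by move=> t; rewrite !inE is_openE.
Qed.

(** In a FIFO order the bins of a sequence with time below [d] form a prefix, so their number
    determines them. *)
Definition order_config s (d : nat) : config k :=
  [ffun l => count (fun b => s b < d) (tnth Q l)].

Lemma removed_order_config s d :
  fifo_order s -> removed Q (order_config s d) = before s d.
Proof.
move/fifo_orderP=> fifo; apply/setP=> b.
have [l bl] := block_ex flatQ b.
rewrite (removedE flatQ _ bl) ffunE -filter_take_count.
  by rewrite mem_filter bl andbT inE.
(* Comparing numbers within a sequence amounts to comparing positions. *)
have sorted_l : pairwise (fun x y : 'I_n => x < y) (tnth Q l).
  have := iota_ltn_sorted (bound Q l) (size (tnth Q l)).
  rewrite -map_val_block // sorted_pairwise; last exact: ltn_trans.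
  by rewrite pairwise_map.
apply: (sub_in_pairwise (P := mem (tnth Q l)) _ _ sorted_l);
  last exact/allP.
move=> x y xl yl lt; apply/implyP; exact: ltn_trans (fifo _ _ _ xl yl lt).
Qed.

Lemma step_order_config s d :
  d < n -> step Q (order_config s d) (order_config s d.+1).
Proof.
move=> dn; set b := (s^-1)%g (Ordinal dn); have [l bl] := block_ex flatQ b.
have sb : s b = Ordinal dn by rewrite permKV.
(* Only [b] has time exactly [d], and it occurs at most once in a sequence. *)
have countS l' : count (fun b' => s b' < d.+1) (tnth Q l') =
    count (fun b' => s b' < d) (tnth Q l') + (b \in tnth Q l').
  rewrite -count_uniq_mem ?(uniq_block flatQ) // -[RHS]count_predUI.
  rewrite [X in _ = _ + X](eq_count (a2 := pred0)) ?count_pred0 ?addn0.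
    apply: eq_count => b' /=; rewrite ltnS leq_eqVlt orbC; congr (_ || _).
    by rewrite -(inj_eq (@perm_inj _ s)) sb.
  by move=> b' /=; case: eqP => [->|]; rewrite ?andbF // sb /= ltnn.
apply/existsP; exists l; apply/andP; split.
  rewrite ffunE; have := count_size (fun b' => s b' < d.+1) (tnth Q l).
  by rewrite countS bl addn1.
apply/eqP/ffunP=> l'; rewrite !ffunE countS; case: eqP => [->|ne].
  by rewrite bl addn1.
case bl' : (b \in _); last by rewrite addn0.
by case: ne; apply: (block_inj flatQ bl' bl).
Qed.

Lemma order_processing s p :
  fifo_order s -> order_width_le s p -> processable_with Q plt p.
Proof.
move=> fifo /order_width_leP width_le.
have init : order_config s 0 = initial_config k.
  by apply/ffunP=> l; rewrite !ffunE (eq_count (a2 := pred0)) ?count_pred0.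
have final : order_config s n = final_config Q.
  apply/ffunP=> l; rewrite !ffunE (eq_count (a2 := predT)) ?count_predT //.
  by move=> b; rewrite /= ltn_ord.
have path_from d a : a + d <= n ->
    path (step Q) (order_config s a) [seq order_config s e | e <- iota a.+1 d].
  elim: d a => //= d IH a le.
  by rewrite step_order_config ?IH ?addSnnS //; apply: leq_trans le; lia.
have last_iota d a : last a (iota a.+1 d) = a + d.
  by elim: d a => [|d IH] a /=; rewrite ?addn0 // IH addSnnS.
exists [seq order_config s d | d <- iota 1 n].
  apply/andP; split; rewrite -init; first exact: path_from.
  by rewrite last_map last_iota final.
move=> c; rewrite -init -map_cons => /mapP[d _ ->].
rewrite (leq_trans _ (width_le d)) // subset_leq_card //.
by apply/subsetP=> t; rewrite !inE is_openE // removed_order_config.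
Qed.

(** * From removal orders to feasible points *)

Local Open Scope ring_scope.

(** [x_] is the permutation matrix of [s]. The positions [j <= c] are the first [c.+1] removals,
    whence the shift in [before s c.+1]. *)
Definition order_point s p : ilp_point n m := {|
  x_ := fun i j => (s i == j)%:R;
  p_ := Posz p;
  g_ := fun t c => [exists b in before s c.+1, plt b == t]%:R;
  h_ := fun t c => [exists b in ~: before s c.+1, plt b == t]%:R;
  f_ := fun t c => (splits plt (before s c.+1) t)%:R |}.

Lemma binary_bool (b : bool) : binary b%:R.
Proof. by case: b; [right | left]. Qed.

Lemma sum_order_row s (i : 'I_n) (P : pred 'I_n) :
  \sum_(j < n | P j) ((s i == j)%:R : int) = (P (s i))%:R.
Proof.
rewrite big_mkcond (bigD1 (s i)) //= eqxx big1 ?addr0; first by case: (P _).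
by move=> j ne; rewrite eq_sym (negbTE ne) if_same.
Qed.

(** The double sum counts the bins of [t] in [A]. With [P] as [j <= c] or [c < j] this serves the
    second halves of (4) and (5). *)
Lemma exists_le_sum s (t : 'I_m) (P : pred 'I_n) (A : {set 'I_n}) :
  (forall i, (i \in A) = P (s i)) ->
  0 <= (\sum_(i < n | plt i == t) \sum_(j < n | P j) ((s i == j)%:R : int))
       - [exists b in A, plt b == t]%:R.
Proof.
move=> hA; case: existsP => [[b /andP[bA bt]]|_].
  rewrite subr_ge0 (bigD1 b) //= sum_order_row -hA bA lerDl.
  by apply: sumr_ge0 => i _; rewrite sum_order_row ler0n.
by rewrite subr0; apply: sumr_ge0 => i _; rewrite sum_order_row ler0n.
Qed.

Lemma sum_splits (A : {set 'I_n}) :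
  \sum_(t < m) ((splits plt A t)%:R : int) = (width plt A)%:Z.
Proof.
rewrite /width -sum1dep_card -natz natr_sum [RHS]big_mkcond.
by apply: eq_bigr => t _; case: splits.
Qed.

Lemma order_feasible s p :
  fifo_order s -> order_width_le s p -> ilp_feasible Q plt (order_point s p).
Proof.
move=> /fifo_orderP fifo /forallP width_le; do 2!split.
- split=> [i j|t c]; first exact: binary_bool.
  by split; apply: binary_bool.
- split=> [i|j] /=; first by rewrite (sum_order_row s i xpredT).
  (* A column sum for [s] is a row sum for its inverse. *)
  rewrite -[RHS](sum_order_row (s^-1)%g j xpredT); apply: eq_bigr => i _.
  by rewrite -[in RHS](inj_eq (@perm_inj _ s)) permKV eq_sym.
(* The inequality could fail only if both entries were 1, which would contradict the order of [i]
   and [i'] in their sequence. *)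
- split=> l i i' j j' h1 h2 h3 lt /=;
    case: eqP => [e'|_]; case: eqP => [e|_] //; exfalso.
    have := fifo l i i'; rewrite !mem_block // e e' => /(_ _ _ h2); lia.
  have := fifo l i' i; rewrite !mem_block // e e' => /(_ _ _ h2); lia.
- by move=> c; rewrite /= sum_splits lez_nat.
- split=> [t c i j it jc /=|t c].
    rewrite subr_le0; case: eqP => [e|//]; rewrite ?ler0n //.
    suff -> : [exists b in before s c.+1, plt b == t] by [].
    by apply/existsP; exists i; rewrite inE e ltnS jc it eqxx.
  by apply: exists_le_sum => i; rewrite inE ltnS.
- split=> [t c i j it jc /=|t c].
    rewrite subr_le0; case: eqP => [e|//]; rewrite ?ler0n //.
    suff -> : [exists b in ~: before s c.+1, plt b == t] by [].
    by apply/existsP; exists i; rewrite !inE e -leqNgt jc it eqxx.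
  by apply: exists_le_sum => i; rewrite !inE -leqNgt.
- by move=> t c; rewrite /= /splits; do 2!case: existsP => _.
Qed.

(** * From feasible points to removal orders *)

Lemma binary_ge0 (v : int) : binary v -> 0 <= v.
Proof. by case=> ->. Qed.

(** The ones of [x_] form a permutation matrix. For a split pallet (4) and (5) force [g] and [h] to
    be 1, then (6) forces [f] to be 1, so (3) bounds the width. *)
Lemma feasible_order v : ilp_feasible Q plt v ->
  exists2 s, fifo_order s &
    forall d : 'I_n.-1, (width plt (before s d.+1))%:Z <= p_ v.
Proof.
case=> [[[xb fb] [row col] [fifo _]] [cap [rem _] [remain _] op]].
have ex i : exists j, x_ v i j == 1.
  apply/existsP; apply: contraT => /existsPn h.
  have := row i; rewrite big1 // => j _.
  by case: (xb i j) => // e; have := h j; rewrite e eqxx.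
pose f i := xchoose (ex i).
have fP i : x_ v i (f i) = 1 by apply/eqP; exact: (xchooseP (ex i)).
(* Two ones in a column would make its sum at least 2, all entries being nonnegative. *)
have f_inj : injective f.
  move=> i i' e; apply/eqP/negPn/negP=> ne.
  have := col (f i); rewrite (bigD1 i) //= (bigD1 i') 1?eq_sym //= fP e fP.
  have : 0 <= \sum_(i0 < n | (i0 != i) && (i0 != i')) x_ v i0 (f i').
    by apply: sumr_ge0 => i0 _; exact: binary_ge0.
  by move: (\sum_(i0 < n | _) _) => S; lia.
exists (perm f_inj).
  apply/fifo_orderP=> l b b'; rewrite !mem_block //.
  move=> /andP[b1 b2] /andP[b3 b4] lt.
  rewrite !permE ltnNge leq_eqVlt; apply/negP=> /orP[/eqP/val_inj/f_inj e|lt'].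
    by rewrite e ltnn in lt.
  by have := fifo l b b' (f b) (f b') b1 lt b4 lt'; rewrite !fP.
move=> d; apply: le_trans (cap d).
rewrite -sum_splits; apply: ler_sum => t _.
case: (boolP (splits _ _ _)) => [|_]; last by apply: binary_ge0; case: (fb t d).
case/andP=> /existsP[b /andP[bA /eqP bt]] /existsP[b' /andP[b'A /eqP b't]].
have [_ _ fgh] := op t d.
have := rem t d b (f b) bt; have := remain t d b' (f b') b't.
move: bA b'A; rewrite !inE !permE -leqNgt ltnS !fP.
by move=> h1 h2 /(_ h2) h3 /(_ h1) h4; lia.
Qed.

End Orders.

(** * Equality of the two optima *)

Theorem theorem6 (k n m : nat) (Q : k.-tuple (seq 'I_n)) (plt : 'I_n -> 'I_m)
  (hQ : fifo_instance Q plt) :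
  exists p : nat,
    min_open_pallets Q plt p /\ ilp_optimal_value Q plt (Posz p).
Proof.
case: hQ => k_gt0 nonempty flatQ two.
(* Some sequence contains a bin, and its pallet has at least two bins. *)
have n_gt1 : (1 < n)%N.
  have := nonempty (Ordinal k_gt0); case: (tnth _ _) => // b _ _.
  apply: leq_trans (two (plt b)) _.
  by rewrite -[X in (_ <= X)%N]card_ord max_card.
pose good p := [exists s, fifo_order Q s && order_width_le plt s p].
have ex_good : exists p, good p.
  (* The identity removes the bins by increasing number, and at most all [m] pallets are open. *)
  exists m; apply/existsP; exists 1%g; apply/andP; split.
    by apply/fifo_orderP=> l b b' _ _; rewrite !perm1.
  by apply/forallP=> d; exact: width_le.
case: (ex_minnP ex_good) => p /existsP[s /andP[fifo wle]] p_min.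
exists p; split; split.
- exact: order_processing fifo wle.
- by move=> p' /(processing_order flatQ)/existsP; exact: p_min.
- by exists (order_point plt s p); first exact: order_feasible.
move=> v /(feasible_order flatQ)[s' fifo' wle'].
(* As [n > 1] there is a column; its width bound makes the integer [p_ v] nonnegative, hence
   comparable with the natural number [p]. *)
have d0 : 'I_n.-1 by exists 0%N; rewrite -subn1 subn_gt0.
have p_ge0 : (0 <= p_ v)%R by exact: le_trans (wle' d0).
rewrite -(gez0_abs p_ge0) lez_nat p_min //; apply/existsP; exists s'.
by rewrite fifo'; apply/forallP=> d; rewrite -lez_nat gez0_abs // wle'.
Qed.
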